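(* Let $I\subset S$ be a Borel fixed ideal generated in one degree $e\le d$ (i.e., all elements of $G(I)$ have degree $e$). Then the Nagel–Reiner description of a minimal free resolution of $\widetilde I=\operatorname{b-pol}(I)$ coincides with $\widetilde P_{\ge1}$, the truncation of $\widetilde P_\bullet$ in homological degrees $\ge1$. That is: assigning to an admissible pair $(\widetilde F,\widetilde m)$ the sequence $(X_1,\dots,X_e)$ with $X_j=\{i\mid (i,j)\in\widetilde F\text{ or }x_{i,j}\mid\widetilde m\}$ defines a bijection from the set of admissible pairs with $\#\widetilde F=q$ onto the set of $q$-dimensional cells of the Nagel–Reiner complex $\mathcal B$ for every $q\ge0$, and, for a suitable choice of incidence function on the regular CW complex $\mathcal B$, this bijection of basis elements identifies $\widetilde P_{\ge1}$ with the cellular free resolution of $\widetilde I$ supported by $\mathcal B$.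
   Context: Let $\Bbbk$ be a field and $S=\Bbbk[x_1,\dots,x_n]$. For a monomial ideal $J$, $G(J)$ denotes its set of minimal monomial generators. A monomial ideal $I\subset S$ is Borel fixed (strongly stable) if $m\in G(I)$, $x_i\mid m$ and $j<i$ imply $(x_j/x_i)\,m\in I$. Let $d$ be an integer with $\deg m\le d$ for all $m\in G(I)$ and $\widetilde S=\Bbbk[x_{i,j}\mid 1\le i\le n,\ 1\le j\le d]$. A monomial $m\in S$ of degree $e\le d$ is written uniquely as $m=\prod_{i=1}^e x_{\alpha_i}$ with $\alpha_1\le\cdots\le\alpha_e$; set $\widetilde m=\operatorname{b-pol}(m):=\prod_{i=1}^e x_{\alpha_i,i}\in\widetilde S$, and $\widetilde I=\operatorname{b-pol}(I):=(\widetilde m\mid m\in G(I))\subset \widetilde S$. For a monomial $m$ let $\mu(m)=\min\{i: x_i\mid m\}$ and $\nu(m)=\max\{i: x_i\mid m\}$ (with $\mu(1)=\infty$). Every monomial $m\in I$ has a unique expression $m=m_1m_2$ with $\nu(m_1)\le\mu(m_2)$ and $m_1\in G(I)$; put $g(m):=m_1$. For a monomial $m=\prod x_l^{a_l}$ and $i<\nu(m)$ put $\mathfrak b_i(m):=(x_i/x_k)\,m$ with $k=\min\{j>i: a_j>0\}$. For $m\in G(I)$ put $m_{\langle i\rangle}:=g(\mathfrak b_i(m))$ if $1\le i<\nu(m)$, $m_{\langle i\rangle}:=m$ if $i\ge\nu(m)$, and $\widetilde m_{\langle i\rangle}:=\operatorname{b-pol}(m_{\langle i\rangle})$. For a finite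 set $\widetilde F=\{(i_1,j_1),\dots,(i_q,j_q)\}\subset\mathbb N\times\mathbb N$ and $m=\prod x_l^{a_l}\in G(I)$, the pair $(\widetilde F,\widetilde m)$ is admissible if (a) $1\le i_1<\cdots<i_q<\nu(m)$ and (b) $j_r=1+\sum_{l=1}^{i_r}a_l$ for all $r$; the pair $(\emptyset,\widetilde m)$ is also admissible. Put $\widetilde F_r:=\widetilde F\setminus\{(i_r,j_r)\}$, and for $(\widetilde F,\widetilde m)$ admissible put $B(\widetilde F,\widetilde m):=\{r\mid 1\le r\le q,\ (\widetilde F_r,\widetilde m_{\langle i_r\rangle})\text{ is admissible}\}$. The complex $\widetilde P_\bullet$: $\widetilde P_0=\widetilde S$, and for $q\ge1$, $\widetilde P_q=\bigoplus \widetilde S\,e(\widetilde F,\widetilde m)$, the sum over admissible pairs with $\#\widetilde F=q-1$, where $e(\widetilde F,\widetilde m)$ has degree $\deg\bigl(\widetilde m\prod_{(i,j)\in\widetilde F}x_{i,j}\bigr)\in\mathbb Z^{n\times d}$. The differential $\partial:\widetilde P_{q+1}\to\widetilde P_q$ ($q\ge1$) sends $e(\widetilde F,\widetilde m)$ with $\widetilde F=\{(i_1,j_1),\dots,(i_q,j_q)\}$, $i_1<\dots<i_q$, to $$\sum_{1\le r\le q}(-1)^r x_{i_r,j_r}\,e(\widetilde F_r,\widetilde m)-\sum_{r\in B(\widetilde F,\widetilde m)}(-1)^r\frac{x_{i_r,j_r}\,\widetilde m}{\widetilde m_{\langle i_r\rangle}}\,e(\widetilde F_r,\widetilde m_{\langle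 i_r\rangle}),$$ and $\partial:\widetilde P_1\to\widetilde P_0$ sends $e(\emptyset,\widetilde m)$ to $\widetilde m$. The module $\widetilde P_{q+1}$ is placed in homological degree $q$ when $\widetilde P_{\ge1}$ is regarded as a resolution of $\widetilde I$. The Nagel–Reiner complex (complex of boxes) $\mathcal B$ of $I$: it is the polytopal subcomplex of the $e$-fold product of simplices with vertex set $\{1,\dots,n\}$ whose cells are the products of simplices on $X_1,\dots,X_e$ for all sequences $(X_1,\dots,X_e)$ of nonempty subsets of $\{1,\dots,n\}$ such that $\max X_j\le\min X_{j+1}$ for all $1\le j<e$ and $x_{i_1}x_{i_2}\cdots x_{i_e}\in I$ for all $(i_1,\dots,i_e)\in X_1\times\cdots\times X_e$. Its cell $(X_1,\dots,X_e)$ has dimension $\sum_j(\#X_j-1)$ and is labelled by the monomial $\prod_{j=1}^e\prod_{i\in X_j}x_{i,j}$; its faces are the cells $(X_1',\dots,X_e')$ with $X'_j\subset X_j$. The cellular complex supported by $\mathcal B$ has in homological degree $q$ the free $\widetilde S$-module with basis $e(c)$, $c$ the $q$-cells of $\mathcal B$, and differential $e(c)\mapsto\sum_{c'}[c:c']\,\frac{\mathrm{label}(c)}{\mathrm{label}(c')}\,e(c')$ over the codimension-one faces $c'$ of $c$, where $[c:c']\in\{\pm1\}$ is an incidence function of the regular CW complex $\mathcal B$; the augmentation sends each vertex $e(c)$ to its label in $\widetilde I$. Nagel and Reiner proved that this is a minimal $\widetilde S$-free resolution of $\widetilde I$. *)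

(* Defs.v *)
From HB Require Import structures.
From mathcomp Require Import all_boot all_order all_algebra.
From mathcomp.multinomials Require Import mpoly.

Set Implicit Arguments.
Unset Strict Implicit.
Unset Printing Implicit Defensive.

Import GRing.Theory.
Local Open Scope ring_scope.

(* Indices are 0-based: 'X_i with i : 'I_n is x_{i+1}, and the variable       *)
(* x_{i+1,j+1} of the polarization ring {mpoly K[n * d]} is 'X_(xvar (i, j)). *)
(* The numbers nu m and mu m below are the 1-based ones, so that they can be  *)
(* compared with i.+1.                                                        *)

Definition ideal_gen (R : comNzRingType) (A : R -> Prop) (p : R) : Prop :=
  exists2 s : seq (R * R), (forall t, t \in s -> A t.2)
    & p = \sum_(t <- s) t.1 * t.2.

Section FreeModules.
Variables (R : comNzRingType) (B : finType).

Definition freemod := {ffun B -> R^o}.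
HB.instance Definition _ := GRing.Lmodule.on freemod.

Definition fbasis (b : B) : freemod := [ffun b' => (b' == b)%:R].

(* the R-linear map with value f b at the basis element b *)
Definition linext (M : lmodType R) (f : B -> M) (v : freemod) : M :=
  \sum_b (v b : R) *: f b.

Fact linext_is_linear (M : lmodType R) (f : B -> M) : linear (linext f).
Proof.
move=> a u v; rewrite /linext scaler_sumr -big_split /=.
by apply: eq_bigr => b _; rewrite !ffunE scalerDl scalerA.
Qed.

HB.instance Definition _ (M : lmodType R) (f : B -> M) :=
  GRing.isLinear.Build R freemod M *:%R (linext f) (linext_is_linear f).

End FreeModules.

Section Monomials.
Variable n : nat.
Implicit Type m : 'X_{1..n}.

Definition xdvd (i : 'I_n) m : bool := (0 < m i)%N.

Definition nu m : nat := \max_(i < n | xdvd i m) i.+1.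

(* n.+1 exceeds every index and stands for mu(1) = infinity *)
Definition mu m : nat := \big[minn/n.+1]_(i < n | xdvd i m) i.+1.

(* the sequence alpha_1 <= ... <= alpha_e with m = x_{alpha_1} ... x_{alpha_e} *)
Definition msorted m : seq 'I_n := flatten [seq nseq (m i) i | i <- enum 'I_n].

Definition bshift (i : 'I_n) m : 'X_{1..n} :=
  if [pick k : 'I_n | [&& i < k, xdvd k m
        & [forall l : 'I_n, (i < l) && xdvd l m ==> (k <= l)]]%N]
  is Some k then (m - U_(k) + U_(i))%MM else m.

Definition xvar d (t : 'I_n * 'I_d) : 'I_(n * d) := mxvec_index t.1 t.2.

(* zip pairs alpha_j with j, for mdeg m <= d *)
Definition bpol d m : 'X_{1..n * d} :=
  (\sum_(t <- zip (msorted m) (enum 'I_d)) U_(xvar t))%MM.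

End Monomials.

Section Ideals.
Variables (K : fieldType) (n : nat).
Implicit Types (I : {pred {mpoly K[n]}}) (m : 'X_{1..n}).

Definition monomial_ideal I : Prop :=
  exists A : 'X_{1..n} -> Prop, forall p : {mpoly K[n]},
    p \in I <-> ideal_gen (fun q => exists2 m, A m & q = 'X_[m]) p.

(* m \in G(I): a monomial of I none of whose proper divisors lies in I *)
Definition mingen I m : bool :=
  ('X_[m] \in I) &&
  [forall m' : 'X_{1..n < (mdeg m).+1},
     (m' <= m)%MM && (bmnm m' != m) ==> ('X_[m'] \notin I)].

Definition borel_fixed I : Prop :=
  monomial_ideal I /\
  forall m (i j : 'I_n), mingen I m -> xdvd i m -> (j < i)%N ->
    'X_[(m - U_(i) + U_(j))%MM] \in I.

Definition generated_in_degree I (e : nat) : Prop :=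
  forall m, mingen I m -> mdeg m = e.

Definition bpol_ideal I d : {mpoly K[n * d]} -> Prop :=
  ideal_gen (fun q => exists2 m, mingen I m & q = 'X_[bpol d m]).

(* for 'X_[m] in I, the unique m1 in G(I) with m = m1 m2 and                  *)
(* nu(m1) <= mu(m2); the default value m is irrelevant                        *)
Definition gfactor I m : 'X_{1..n} :=
  if [pick m1 : 'X_{1..n < (mdeg m).+1} |
        [&& mingen I m1, (m1 <= m)%MM & (nu m1 <= mu (m - m1)%MM)%N]]
  is Some m1 then bmnm m1 else m.

Definition mangle I m (i : 'I_n) : 'X_{1..n} :=
  if (i.+1 < nu m)%N then gfactor I (bshift i m) else m.

Section Admissible.
Variable d : nat.
Implicit Type F : {set 'I_n * 'I_d}.

(* The pair (F, bpol m) is represented by (F, m), m being determined by       *)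
(* bpol m. With 1-based j_r the last condition reads                          *)
(* j_r = 1 + \sum_(l <= i_r) a_l for m = \prod_l x_l^{a_l}.                   *)
Definition admissible I F m : bool :=
  [&& mingen I m,
      [forall t in F, forall t' in F, (t != t') ==> (t.1 != t'.1)],
      [forall t in F, t.1.+1 < nu m]%N
    & [forall t in F, t.2 == (\sum_(l < n | l <= t.1) m l)%N :> nat]].

(* the r with t = (i_r, j_r), when the i_r are listed increasingly from r = 1 *)
Definition frank F (t : 'I_n * 'I_d) : nat :=
  #|[set t' in F | (t'.1 <= t.1)%N]|.

Definition bset I F m : {set 'I_n * 'I_d} :=
  [set t in F | admissible I (F :\ t) (mangle I m t.1)].

Definition admdeg F m : 'X_{1..n * d} :=
  (bpol d m + \sum_(t in F) U_(xvar t))%MM.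

(* admissible pairs with q elements in F; elements of G(I) have degree <= d *)
Definition adm I (q : nat) :=
  {p : {set 'I_n * 'I_d} * 'X_{1..n < d.+1}
     | admissible I p.1 p.2 && (#|p.1| == q)}.

Notation Spol := {mpoly K[n * d]}.

(* the basis element e(F, m) in homological degree q, for (F, m) in adm I q;  *)
(* zero on other pairs                                                        *)
Definition admbasis I q F m : freemod Spol (adm I q) :=
  [ffun p => (((val p).1 == F) && (bmnm (val p).2 == m))%:R].

(* The truncated subtraction of exponents is exact for t in bset I F m. *)
Definition diffP_basis I q (p : adm I q.+1) : freemod Spol (adm I q) :=
  let F := (val p).1 in let m := bmnm (val p).2 in
  \sum_(t in F) ((-1) ^+ frank F t * 'X_(xvar t) : Spol)
                  *: admbasis I q (F :\ t) m
  - \sum_(t in bset I F m)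
      ((-1) ^+ frank F t
         * 'X_[(U_(xvar t) + bpol d m - bpol d (mangle I m t.1))%MM] : Spol)
        *: admbasis I q (F :\ t) (mangle I m t.1).

(* The complex P_{>= 1}, placed so that P_{q+1} has homological degree q *)
Definition diffP I q : freemod Spol (adm I q.+1) -> freemod Spol (adm I q) :=
  linext (@diffP_basis I q).

Definition augP I : freemod Spol (adm I 0) -> Spol^o :=
  linext (fun p : adm I 0 => 'X_[bpol d (val p).2] : Spol^o).

End Admissible.
Section Boxes.
Variables (d e : nat) (hed : (e <= d)%N).
Local Notation box := {ffun 'I_e -> {set 'I_n}}.
Implicit Types X Y Z : box.

Definition is_cell I X : bool :=
  [&& [forall j, X j != set0],
      [forall j : 'I_e, forall j' : 'I_e, (j.+1 == j')%N ==>
         [forall a in X j, forall b in X j', a <= b]%N]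
    & [forall f : {ffun 'I_e -> 'I_n}, [forall j, f j \in X j] ==>
         ('X_[(\sum_j U_(f j))%MM] \in I)]].

Definition boxdim X : nat := \sum_(j < e) (#|X j|).-1.

Definition boxlabel X : 'X_{1..n * d} :=
  (\sum_(j < e) \sum_(i in X j) U_(xvar (i, widen_ord hed j)))%MM.

Definition boxface Y X : bool := [forall j, Y j \subset X j].

Definition boxfacet Y X : bool := boxface Y X && (boxdim X == (boxdim Y).+1).

Definition cell I (q : nat) := {X : box | is_cell I X && (boxdim X == q)}.

(* Incidence functions on the regular CW complex of boxes. The third clause   *)
(* is the codimension-two condition for the empty face of an edge, where      *)
(* every vertex has incidence number 1 with the empty cell.                   *)
Definition is_incidence I (inc : box -> box -> int) : Prop :=
  [/\ forall X Y, is_cell I X -> is_cell I Y ->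
        inc X Y \in [:: 1; 0; -1],
      forall X Y, is_cell I X -> is_cell I Y ->
        (inc X Y != 0) = boxfacet Y X,
      forall X Y1 Y2, is_cell I X -> is_cell I Y1 -> is_cell I Y2 ->
        boxdim X = 1%N -> Y1 != Y2 -> boxfacet Y1 X -> boxfacet Y2 X ->
        inc X Y1 + inc X Y2 = 0
    & forall X Y1 Y2 Z, is_cell I X -> is_cell I Y1 -> is_cell I Y2 ->
        is_cell I Z -> Y1 != Y2 ->
        boxfacet Y1 X -> boxfacet Y2 X -> boxfacet Z Y1 -> boxfacet Z Y2 ->
        inc X Y1 * inc Y1 Z + inc X Y2 * inc Y2 Z = 0].

Notation Spol := {mpoly K[n * d]}.

(* The subtraction of exponents is exact, as the label of a face divides the  *)
(* label of the cell.                                                         *)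
Definition diffC_basis I (inc : box -> box -> int) q (c : cell I q.+1) :
    freemod Spol (cell I q) :=
  \sum_(c' : cell I q | boxfacet (val c') (val c))
    ((inc (val c) (val c'))%:~R
       * 'X_[(boxlabel (val c) - boxlabel (val c'))%MM] : Spol)
      *: fbasis Spol c'.

Definition diffC I inc q :
    freemod Spol (cell I q.+1) -> freemod Spol (cell I q) :=
  linext (@diffC_basis I inc q).

Definition augC I : freemod Spol (cell I 0) -> Spol^o :=
  linext (fun c : cell I 0 => 'X_[boxlabel (val c)] : Spol^o).

Definition box_of (F : {set 'I_n * 'I_d}) m : box :=
  [ffun j : 'I_e => [set i : 'I_n |
     ((i, widen_ord hed j) \in F)
     || xdvd (xvar (i, widen_ord hed j)) (bpol d m)]].

End Boxes.
End Ideals.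

(* Main.v *)
(* Write a monomial m of degree e as a nondecreasing word a_1 <= ... <= a_e.  *)
(* A pair (F, m) is admissible iff a_(j-1) <= i < a_j for all (i, j) in F, so *)
(* the column X_j consists of a_j together with the smaller i such that       *)
(* (i, j) is in F: the word is recovered from a cell as the sequence of the   *)
(* max X_j, and F as the set of the remaining points. All words picked in     *)
(* such a cell lie below a, so Borel stability puts them in I.                *)
(* The facets of a cell are obtained by removing one point from a column with *)
(* at least two elements. Removing a point of F gives the first sum of the    *)
(* differential. Removing a_j amounts to replacing a_j by the maximum i of    *)
(* X_j \ {a_j} in the word and to deleting (i, j) from F; the (i, j) arising  *)
(* in this way are exactly those of B(F, m), which gives the second sum. The  *)
(* incidence number is, up to a correction by the column number, (-1) to the  *)
(* rank of the removed point of the cell in the order by columns; there       *)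
(* (a_j, j) is the successor of (i, j), whence the opposite signs of the two  *)
(* sums.                                                                      *)

Require Import Defs.
From mathcomp Require Import all_boot all_order all_algebra.
From mathcomp.multinomials Require Import mpoly.

Set Implicit Arguments.
Unset Strict Implicit.
Unset Printing Implicit Defensive.

Import GRing.Theory.
Local Open Scope ring_scope.

(** * Monomials as nondecreasing words *)

(** Both bases are parametrized by the same data: pairs [(a, F)] with [wadm a F], where [a] is a
    nondecreasing word of length [e] and [F] a set of points (letter, column). As [I] is generated
    in the single degree [e], its minimal generators are exactly its monomials of degree [e]
    ([mingenE]). Hence [gfactor] acts as the identity where it is applied, and passing from m to
    m_<i> at a point of [F] replaces one letter ([mangle_wmon]). Admissible pairs are translated by
    [admissibleP] and [word_adm], cells by [wbox_cell], [is_cell_word] and [wbox_inj].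

    A facet of a box loses one point, so incidence numbers can be read off from positions in a
    linear order of the points ([binc_incidence]), and the cellular boundary is a sum over removable
    points ([diffC_basisE]). By [removable_wbox] these are the points of [F] and the tops of the
    columns that meet [F]. They match the two sums of the differential term by term: faces by
    [wbox_del] and [wbox_upd], coefficients by [boxlabel_del] and [bpol_upd], signs by [bpos_wbox]
    and [bpos_last]. All this is assembled in [cellmap_diffP_basis]. *)

Section Words.
Variables n e : nat.
Implicit Types (a f : 'I_e -> 'I_n) (m : 'X_{1..n}) (s : 'I_n * 'I_e).

Definition wmon a : 'X_{1..n} := (\sum_j U_(a j))%MM.

Definition nondecr a : Prop := forall j k : 'I_e, (j <= k)%N -> (a j <= a k)%N.

Lemma eq_wmon a f : a =1 f -> wmon a = wmon f.
Proof. by move=> eq_af; apply: eq_bigr => j _; rewrite eq_af. Qed.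

Lemma wmonE a i : wmon a i = (\sum_j (a j == i))%N.
Proof. by rewrite /wmon mnm_sumE; apply: eq_bigr => j _; rewrite mnm1E. Qed.

Lemma xdvd_wmon a i : xdvd i (wmon a) = [exists j, a j == i].
Proof.
rewrite /xdvd wmonE lt0n sum_nat_eq0 negb_forall.
by apply: eq_existsb => j; rewrite eqb0 negbK.
Qed.

Lemma mdeg_wmon a : mdeg (wmon a) = e.
Proof.
rewrite /wmon mdeg_sum (eq_bigr (fun=> 1%N)) => [|j _]; last by rewrite mdeg1.
by rewrite sum1_card card_ord.
Qed.

Lemma count_msorted m i : count_mem i (msorted m) = m i.
Proof.
rewrite count_flatten -map_comp sumnE big_map big_enum /= (bigD1 i) //=.
rewrite count_nseq /= eqxx mul1n big1 ?addn0 // => k ne_ki.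
by rewrite count_nseq /= (negbTE ne_ki).
Qed.

Lemma size_msorted m : size (msorted m) = mdeg m.
Proof.
rewrite size_flatten /shape -map_comp sumnE big_map big_enum /= mdegE.
by apply: eq_bigr => i _; rewrite size_nseq.
Qed.

Lemma sorted_msorted m : sorted (fun i k : 'I_n => i <= k)%N (msorted m).
Proof.
have leq_tr : transitive (fun i k : 'I_n => i <= k)%N.
  by move=> y x z; apply: leq_trans.
rewrite (sorted_pairwise leq_tr).
have: pairwise (fun i k : 'I_n => i <= k)%N (enum 'I_n).
  rewrite -(sorted_pairwise leq_tr) -(@sorted_map _ _ (@nat_of_ord n) leq).
  by rewrite val_enum_ord iota_sorted.
rewrite /msorted; elim: (enum 'I_n) => //= i s IHs /andP[/allP le_is /IHs ps].
rewrite pairwise_cat ps andbT; apply/andP; split.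
  apply/allrelP => x y /nseqP[-> _] /flattenP[_ /mapP[k /le_is le_ik ->]].
  by case/nseqP=> ->.
by elim: (m i) => //= k ->; rewrite andbT all_nseq leqnn orbT.
Qed.

Lemma msorted_wmon a : nondecr a ->
  msorted (wmon a) = [seq a j | j <- enum 'I_e].
Proof.
move=> a_nd; apply: (@sorted_eq _ (fun i k : 'I_n => i <= k)%N).
- by move=> y x z; apply: leq_trans.
- by move=> x y le_xy; apply/val_inj/anti_leq.
- exact: sorted_msorted.
- apply: (@homo_sorted _ _ a (fun j k : 'I_e => j <= k)%N) => //.
  rewrite -(@sorted_map _ _ (@nat_of_ord e) leq) val_enum_ord.
  exact: iota_sorted.
- apply/allP => i _ /=; rewrite count_msorted wmonE count_map -sum1_count.
  by rewrite big_enum_cond [X in _ == X]big_mkcond.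
Qed.

Lemma wmonP m : mdeg m = e -> exists2 a, nondecr a & m = wmon a.
Proof.
move=> deg_m; have sz : size (msorted m) = e by rewrite size_msorted.
pose a (j : 'I_e) : 'I_n := tnth (tcast sz (in_tuple (msorted m))) j.
have aE i j : a j = nth i (msorted m) j by rewrite /a (tnth_nth i) val_tcast.
have amap : msorted m = [seq a j | j <- enum 'I_e].
  case: (posnP e) => [e0 | e_gt0].
    have ->: enum 'I_e = [::] by apply/size0nil; rewrite size_enum_ord.
    by apply/size0nil; rewrite sz.
  apply: (@eq_from_nth _ (a (Ordinal e_gt0)));
    first by rewrite size_map size_enum_ord.
  move=> k; rewrite sz => lt_ke.
  rewrite (nth_map (Ordinal e_gt0)) ?size_enum_ord //.
  by rewrite [RHS](aE (a (Ordinal e_gt0))) nth_enum_ord.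
exists a => [j k le_jk|].
  rewrite (aE (a j)) [X in (_ <= nat_of_ord X)%N](aE (a j)).
  apply: (@sorted_leq_nth _ (fun i k : 'I_n => i <= k)%N); rewrite ?inE ?sz //.
    by move=> y x z; apply: leq_trans.
  exact: sorted_msorted.
apply/mnmP => i; rewrite wmonE -count_msorted amap count_map -sum1_count.
by rewrite big_enum_cond big_mkcond.
Qed.

Lemma lt_nu_wmon a (i : 'I_n) :
  (i.+1 < nu (wmon a))%N = [exists j, (i < a j)%N].
Proof.
rewrite ltnNge; apply/idP/idP => [|/existsP[j lt_iaj]].
  apply: contraNT; rewrite negb_exists => /forallP no_j.
  apply/bigmax_leqP => k; rewrite xdvd_wmon => /existsP[j /eqP<-].
  by rewrite ltnS leqNgt.
rewrite -ltnNge; apply: (@leq_trans (a j).+1) => //.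
by rewrite /nu (@leq_bigmax_cond _ _ (fun i : 'I_n => i.+1)) // xdvd_wmon;
  apply/existsP; exists j.
Qed.

Lemma sum_wmon a (i : 'I_n) :
  (\sum_(l < n | l <= i) wmon a l)%N = #|[set j | (a j <= i)%N]|.
Proof.
under eq_bigr do rewrite wmonE.
rewrite exchange_big /= -sum1_card [RHS]big_mkcond /=; apply: eq_bigr => j _.
rewrite inE -big_mkcondr /=; case: ifP => le_ai.
  rewrite (big_pred1 (a j)) // => l /=.
  by rewrite eq_sym andbC; case: eqP => // ->.
by rewrite big_pred0 // => l; case: eqP => [<-|]; rewrite ?le_ai ?andbF.
Qed.

Lemma card_ord_lt k : (k <= e)%N -> #|[set j : 'I_e | (j < k)%N]| = k.
Proof.
move=> le_ke; rewrite -sum1_card (eq_bigl (fun j : 'I_e => (j < k)%N));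
  last first.
  by move=> j; rewrite inE.
by rewrite (big_ord_narrow le_ke) sum1_card card_ord.
Qed.

(** Comparison with the initial segments of sizes [j] and [j.+1]. This turns the letter count of
    condition (b) into inequalities between letters. *)
Lemma down_closed_mem (A : {set 'I_e}) :
    (forall j k : 'I_e, (j <= k)%N -> k \in A -> j \in A) ->
  forall j : 'I_e, (j \in A) = (j < #|A|)%N.
Proof.
move=> dA j; apply/idP/idP => [jA|].
  rewrite -[j.+1](card_ord_lt (ltn_ord j)); apply/subset_leq_card/subsetP => k.
  by rewrite inE ltnS => /dA; apply.
apply: contraTT => jNA; rewrite -leqNgt -[leqRHS](card_ord_lt (ltnW (ltn_ord
  j))).
apply/subset_leq_card/subsetP => k kA; rewrite inE ltnNge.
by apply: contra jNA => /dA; apply.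
Qed.

(* For nondecreasing [a], the condition on [s] for [wid s] to belong to some  *)
(* [F] with [(F, wmon a)] admissible.                                         *)
Definition wpos a s : bool :=
  (s.1 < a s.2)%N && [forall k : 'I_e, (k < s.2)%N ==> (a k <= s.1)%N].

(** In a nondecreasing word the letters that are at most [s.1] form an initial segment, so [s.2] is
    their number iff it is the 0-based position of the first larger letter. *)
Lemma wposP a s : nondecr a ->
  (s.2 == #|[set j | (a j <= s.1)%N]| :> nat) = wpos a s.
Proof.
move=> a_nd; set A := [set j | _].
have memA := @down_closed_mem A.
have {}memA j : (j \in A) = (j < #|A|)%N.
  by apply: memA => {}j k /a_nd le_a; rewrite !inE; apply: leq_trans.
apply/eqP/andP => [sA | [s2NA /forallP s2A]].
  split; first by rewrite ltnNge; have := memA s.2; rewrite inE sA ltnn => ->.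
  by apply/forallP => k; apply/implyP; rewrite sA -memA inE.
apply/eqP; rewrite eqn_leq; apply/andP; split; last first.
  by rewrite leqNgt -memA inE -ltnNge.
rewrite leqNgt; apply/negP => ltAs.
have lt_e : (#|A| < e)%N by apply: ltn_trans ltAs _.
have := s2A (Ordinal lt_e); rewrite ltAs /=.
by have := memA (Ordinal lt_e); rewrite inE ltnn /= => ->.
Qed.

End Words.

(** * Polarization of a word *)

Section Polarization.
Variables (n d e : nat) (hed : (e <= d)%N).
Implicit Types (a : 'I_e -> 'I_n) (s : 'I_n * 'I_e).

Definition wid s : 'I_n * 'I_d := (s.1, widen_ord hed s.2).

Lemma wid_inj : injective wid.
Proof. by move=> [i j] [i' j'] [-> /val_inj ->]. Qed.

Lemma xvar_inj : injective (@xvar n d).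
Proof.
by move=> [i j] [i' j'] /cast_ord_inj/enum_rank_inj.
Qed.

(** The sorted word of [wmon a] is [a] itself, and since [e <= d] the [zip] in [bpol] loses none of
    its letters. *)
Lemma bpol_wmon a : nondecr a ->
  bpol d (wmon a) = (\sum_j U_(xvar (wid (a j, j))))%MM.
Proof.
move=> a_nd; rewrite /bpol msorted_wmon //.
have -> : zip [seq a j | j <- enum 'I_e] (enum 'I_d) =
          [seq wid (a j, j) | j <- enum 'I_e].
  have sz : size (zip [seq a j | j <- enum 'I_e] (enum 'I_d)) = e.
    by rewrite size_zip size_map !size_enum_ord; apply/minn_idPl.
  case: (posnP e) => [e0 | e_gt0].
    have ->: enum 'I_e = [::] by apply/size0nil; rewrite size_enum_ord.
    by apply/size0nil; rewrite /=; case: (enum _).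
  pose j0 := Ordinal e_gt0.
  apply: (@eq_from_nth _ (wid (a j0, j0))); rewrite sz.
    by rewrite size_map size_enum_ord.
  move=> k lt_ke; rewrite nth_zip_cond sz lt_ke.
  rewrite !(nth_map j0) -?enumT ?size_enum_ord // /wid /=.
  congr (_, _); apply: val_inj; rewrite /=.
  by rewrite nth_enum_ord /= ?nth_enum_ord //; apply: leq_trans hed.
by rewrite big_map big_enum.
Qed.

Lemma xdvd_bpol a s : nondecr a ->
  xdvd (xvar (wid s)) (bpol d (wmon a)) = (s.1 == a s.2).
Proof.
move=> a_nd; rewrite bpol_wmon // /xdvd mnm_sumE lt0n sum_nat_eq0 negb_forall.
apply/existsP/eqP => [[j]|s1].
  rewrite /= mnm1E eqb0 negbK (inj_eq xvar_inj) (inj_eq wid_inj).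
  by move/eqP=> <-.
by exists s.2; rewrite /= mnm1E -s1 -surjective_pairing eqxx.
Qed.

End Polarization.

(** * Admissible pairs *)

Section Update.
Variables n e : nat.
Implicit Types (a f : 'I_e -> 'I_n) (s t : 'I_n * 'I_e).

Definition wupd a s : 'I_e -> 'I_n := fun j => if j == s.2 then s.1 else a j.

Lemma wmon_upd a s : wmon (wupd a s) = (wmon a - U_(a s.2) + U_(s.1))%MM.
Proof.
rewrite /wmon (bigD1 s.2) //= [in RHS](bigD1 s.2) //= {1}/wupd eqxx.
rewrite (eq_bigr (fun j => U_(a j)%MM)) => [|j /negPf ne_j]; last first.
  by rewrite /wupd ne_j.
by rewrite [(U_(a _) + _)%MM]addmC addmK addmC.
Qed.

Lemma wupd_le a s : wpos a s -> forall j, (wupd a s j <= a j)%N.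
Proof.
by case/andP=> lt_s _ j; rewrite /wupd; case: eqP => [->|//]; apply: ltnW.
Qed.

Lemma wupd_nondecr a s : nondecr a -> wpos a s -> nondecr (wupd a s).
Proof.
move=> a_nd s_pos j k le_jk; have [lt_s /forallP le_s] := andP s_pos.
case: (eqVneq k s.2) => [k_s|ne_k]; last first.
  by rewrite {2}/wupd (negPf ne_k); apply: leq_trans (wupd_le s_pos j) (a_nd _
    _ le_jk).
rewrite /wupd k_s eqxx; case: eqP => // /eqP ne_j.
by apply: (implyP (le_s j)); rewrite ltn_neqAle (inj_eq val_inj) ne_j -k_s.
Qed.

(** The bounds [a k <= t.1] survive the lowering of a letter; only [t.1 < a t.2] can fail, and only
    in the column that changes. *)
Lemma wpos_upd a s t : wpos a s -> wpos a t ->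
  wpos (wupd a s) t = (t.2 == s.2) ==> (t.1 < s.1)%N.
Proof.
move=> s_pos /andP[lt_t /forallP le_t]; rewrite /wpos {1}/wupd.
have -> : [forall k : 'I_e, (k < t.2)%N ==> (wupd a s k <= t.1)%N].
  apply/forallP => k; apply/implyP => lt_k.
  exact: leq_trans (wupd_le s_pos k) (implyP (le_t k) lt_k).
by rewrite andbT; case: eqP.
Qed.

End Update.

(** * Generators and admissibility in terms of words *)

Section Admissible.
Variables (K : fieldType) (n d e : nat) (hed : (e <= d)%N).
Variables (I : {pred {mpoly K[n]}}).
Hypotheses (hI : borel_fixed I) (hdeg : generated_in_degree I e).
Implicit Types (a f : 'I_e -> 'I_n) (s t : 'I_n * 'I_e) (F : {set 'I_n * 'I_e}).

Lemma lepm_deg m m' : (m' <= m)%MM -> (mdeg m <= mdeg m')%N ->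
  m' = m :> 'X_{1..n}.
Proof.
move=> le_m'm le_deg; rewrite -[RHS](submK le_m'm).
suff -> : (m - m')%MM = 0%MM by rewrite add0m.
by apply/eqP; rewrite -mdeg_eq0 -leqn0 -(leq_add2r (mdeg m')) -mdegD submK.
Qed.

Lemma mingen_divisor m : 'X_[m] \in I -> exists2 m', mingen I m' & (m' <= m)%MM.
Proof.
have [k] := ubnP (mdeg m); elim: k m => // k IHk m le_m Im.
have [|/nandP[/negP//|]] := boolP (mingen I m).
  by exists m => //; apply: lepm_refl.
rewrite negb_forall => /existsP[m']; rewrite negb_imply negbK.
case/andP=> /andP[le_m'm ne_m'm] Im'.
have lt_m'm : (mdeg m' < mdeg m)%N.
  by rewrite ltnNge; apply: contra ne_m'm => /(lepm_deg le_m'm) ->.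
have [m1 gen_m1 le_m1] := IHk m' (leq_trans lt_m'm le_m) Im'.
by exists m1 => //; apply: lepm_trans le_m'm.
Qed.

(** A minimal generator dividing a monomial of degree [e] in [I] has degree [e] too, hence equals
    it. *)
Lemma mingenE m : mingen I m = ('X_[m] \in I) && (mdeg m == e).
Proof.
apply/idP/andP => [gen_m|[Im /eqP deg_m]].
  by split; [case/andP: gen_m | rewrite hdeg].
have [m' gen_m' le_m'm] := mingen_divisor Im.
by rewrite -(lepm_deg le_m'm) // deg_m hdeg.
Qed.

(** The letters are lowered one at a time, by induction on the number of positions where the words
    differ. The Borel condition speaks of minimal generators, but each intermediate monomial has
    degree [e] and is one by [mingenE]. *)
Lemma borel_wmon a f : 'X_[wmon a] \in I -> (forall j, f j <= a j)%N ->
  'X_[wmon f] \in I.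
Proof.
have [k] := ubnP #|[set j | f j != a j]|; elim: k a => // k IHk a le_k Ia le_fa.
have [/forallP eq_fa|] := boolP [forall j, f j == a j].
  by rewrite (@eq_wmon _ _ f a) // => j; apply/eqP.
rewrite negb_forall => /existsP[j ne_j].
apply: (IHk (wupd a (f j, j))) => [||l]; last first.
- by rewrite /wupd; case: eqP => [->|].
- rewrite wmon_upd; apply: hI.2.
  + by rewrite mingenE Ia mdeg_wmon /=.
  + by rewrite xdvd_wmon; apply/existsP; exists j.
  + by rewrite /= ltn_neqAle (inj_eq val_inj) ne_j le_fa.
rewrite ltnS in le_k; apply: leq_trans le_k; apply/proper_card/properP; split.
  apply/subsetP => l; rewrite !inE /wupd; by case: (eqVneq l j) => [->|].
by exists j; rewrite !inE // /wupd eqxx negbK.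
Qed.

Lemma mingen_upd a s : wpos a s -> mingen I (wmon a) ->
  mingen I (wmon (wupd a s)).
Proof.
rewrite !mingenE !mdeg_wmon => s_pos /andP[Ia _].
by rewrite (borel_wmon Ia (wupd_le s_pos)) /=.
Qed.

Lemma gfactor_mingen m : mingen I m -> gfactor I m = m.
Proof.
move=> gen_m; rewrite /gfactor; case: pickP => [m1|/(_ (BMultinom (ltnSn (mdeg
  m))))] /=.
  by case/and3P=> gen_m1 le_m1 _; apply: lepm_deg le_m1 _;
    rewrite (hdeg gen_m1) (hdeg gen_m).
(* The search cannot fail: [m] itself qualifies, because its cofactor is 1, where [mu] takes the
   value [n.+1]. *)
have -> : (m - m)%MM = 0%MM by apply/mnmP => i; rewrite mnmBE subnn mnm0E.
rewrite gen_m lepm_refl /mu big_pred0 /=; last by move=> i; rewrite /xdvd mnm0E.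
by move/negbT/negP; case; apply/bigmax_leqP => i _; apply: leqW (ltn_ord i).
Qed.

(** The least variable above x_i dividing the monomial is the letter of column [s.2]: earlier
    letters are at most i, later ones at least [a s.2]. *)
Lemma bshift_wmon a s : nondecr a -> wpos a s ->
  bshift s.1 (wmon a) = wmon (wupd a s).
Proof.
move=> a_nd /andP[lt_s /forallP le_s]; rewrite wmon_upd /bshift.
case: pickP => [k|/(_ (a s.2))]; last first.
  rewrite lt_s xdvd_wmon; case: existsP => [_|[]]; last by exists s.2.
  move/negbT; rewrite negb_forall => /existsP[l].
  rewrite negb_imply xdvd_wmon => /andP[/andP[lt_l /existsP[j /eqP def_l]]].
  case/negP; rewrite -def_l; apply: a_nd; rewrite leqNgt; apply/negP => lt_j.
  by have := implyP (le_s j) lt_j; rewrite def_l leqNgt lt_l.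
case/and3P=> lt_k; rewrite xdvd_wmon => /existsP[j /eqP def_k] /forallP min_k.
suff -> : k = a s.2 by [].
apply/val_inj/anti_leq/andP; split.
  apply: (implyP (min_k _)); rewrite lt_s xdvd_wmon.
  by apply/existsP; exists s.2.
rewrite -def_k; apply: a_nd; rewrite leqNgt; apply/negP => lt_j.
by have := implyP (le_s j) lt_j; rewrite def_k leqNgt lt_k.
Qed.

Lemma mangle_wmon a s : nondecr a -> mingen I (wmon a) -> wpos a s ->
  mangle I (wmon a) s.1 = wmon (wupd a s).
Proof.
move=> a_nd gen_a s_pos; rewrite /mangle lt_nu_wmon.
case: existsP => [_|[]]; last by exists s.2; case/andP: s_pos.
by rewrite bshift_wmon // gfactor_mingen // mingen_upd.
Qed.

(** Condition (b) determines the column from the first coordinate, so distinct points have distinct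
    first coordinates; what remains is a condition on each point separately, which [wposP]
    identifies with [wpos]. *)
Lemma admissible_wmon a F : nondecr a ->
  admissible I (wid hed @: F) (wmon a) =
    mingen I (wmon a) && [forall s in F, wpos a s].
Proof.
move=> a_nd; rewrite /admissible; case: mingen => //=.
apply/and3P/forall_inP => [[_ _ /forall_inP pF] s sF|pF]; first by
  have := pF _ (imset_f (wid hed) sF); rewrite sum_wmon (wposP s a_nd).
have {}pF (u : 'I_n * 'I_d) : u \in wid hed @: F -> exists s, [/\ s \in F, u =
  wid hed s & wpos a s].
  by case/imsetP=> s sF ->; exists s; split => //; apply: pF.
split.
- apply/forall_inP => _ /pF[s [_ -> s_pos]];
  apply/forall_inP => _ /pF[t [_ -> t_pos]].
  apply/implyP; apply: contraNneq => /= eq1; apply/eqP; congr (wid _ _).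
  move: s_pos t_pos; rewrite -!wposP // eq1 => /eqP <- /eqP/val_inj eq2.
  by rewrite [s]surjective_pairing [t]surjective_pairing eq1 eq2.
- apply/forall_inP => _ /pF[s [_ -> /andP[lt_s _]]]; rewrite lt_nu_wmon.
  by apply/existsP; exists s.2.
- by apply/forall_inP => _ /pF[s [_ -> s_pos]]; rewrite sum_wmon (wposP s a_nd).
Qed.

Lemma admissibleP (F : {set 'I_n * 'I_d}) m : admissible I F m ->
  exists a, exists2 F' : {set 'I_n * 'I_e}, nondecr a /\ m = wmon a &
    [/\ F = wid hed @: F', mingen I (wmon a) & forall s, s \in F' -> wpos a s].
Proof.
move=> admF; have /and4P[gen_m _ /forall_inP ltF /forall_inP eqF] := admF.
have [a a_nd def_m] := wmonP (hdeg gen_m);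
  rewrite def_m in admF gen_m ltF eqF *.
have defF : F = wid hed @: (wid hed @^-1: F).
  apply/setP => t; apply/idP/imsetP => [tF|[s]]; last by rewrite inE => ? ->.
  suff lt_t : (t.2 < e)%N.
    have def_t : t = wid hed (t.1, Ordinal lt_t).
      by case: t {tF} lt_t => i j lt_j; congr (_, _); apply: val_inj.
    by exists (t.1, Ordinal lt_t); rewrite // inE -def_t.
  (* The column index counts the letters that are at most [t.1]; condition (a) provides a larger
     letter, so the count is less than [e]. *)
  rewrite (eqP (eqF t tF)) sum_wmon.
  have := ltF t tF; rewrite lt_nu_wmon => /existsP[j lt_j].
  rewrite -[ltnRHS]card_ord -cardsT; apply/proper_card/properP; split=> //.
  by exists j; rewrite // inE -ltnNge.
exists a; exists (wid hed @^-1: F); split=> //.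
by move: admF; rewrite defF admissible_wmon // => /andP[_ /forall_inP];
  rewrite -defF.
Qed.

Lemma mem_box_of a F i j : nondecr a ->
  (i \in box_of hed (wid hed @: F) (wmon a) j) = ((i, j) \in F) || (i == a j).
Proof.
move=> a_nd; rewrite ffunE inE -[(i, widen_ord hed j)]/(wid hed (i, j))
  xdvd_bpol //.
by rewrite (mem_imset _ _ (@wid_inj _ _ _ hed)).
Qed.

Lemma wid_imsetD1 F s : wid hed @: (F :\ s) = (wid hed @: F) :\ wid hed s.
Proof.
apply/setP => u; apply/imsetP/setD1P => [[t /setD1P[ne_t tF] ->]|[ne_u]].
  by rewrite (inj_eq (@wid_inj _ _ _ hed)) ne_t imset_f.
case/imsetP=> t tF def_u; exists t => //; rewrite !inE tF andbT.
by apply: contraNneq ne_u => <-; apply/eqP.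
Qed.

(** By [wpos_upd], replacing the letter of column [s.2] by [s.1] keeps the points of other columns
    admissible, and those of this column iff they lie below [s.1]. So B(F, m) picks the largest
    point of each column that meets [F]. *)
Lemma mem_bset a F s : nondecr a -> mingen I (wmon a) ->
    (forall t, t \in F -> wpos a t) ->
  (wid hed s \in bset I (wid hed @: F) (wmon a)) =
    (s \in F) && [forall t in F, (t.2 == s.2) ==> (t.1 <= s.1)%N].
Proof.
move=> a_nd gen_a posF; rewrite inE (mem_imset _ _ (@wid_inj _ _ _ hed)).
case sF: (s \in F) => //=; have s_pos := posF s sF.
rewrite -wid_imsetD1 mangle_wmon // admissible_wmon ?mingen_upd //=;
  last exact: wupd_nondecr.
apply/forall_inP/forall_inP => [pos_t t tF|le_t t].
  apply/implyP => eq_t; case: (eqVneq t s) => [->//|ne_t].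
  have := pos_t t; rewrite !inE ne_t tF wpos_upd ?eq_t; last exact: posF.
    by move/(_ isT); apply: ltnW.
  by [].
rewrite !inE => /andP[ne_t tF]; rewrite wpos_upd //; last exact: posF.
apply/implyP => eq_t; have := le_t t tF; rewrite eq_t /= leq_eqVlt => /orP[|//].
move/eqP/val_inj => eq1; case/eqP: ne_t.
by rewrite [s]surjective_pairing [t]surjective_pairing eq1 (eqP eq_t).
Qed.

End Admissible.

(** * Incidence numbers of boxes *)

Section Points.
Variables n e : nat.
Local Notation box := {ffun 'I_e -> {set 'I_n}}.
Implicit Types (X Y Z : box) (s t : 'I_n * 'I_e).

Definition pts X : {set 'I_n * 'I_e} := [set s | s.1 \in X s.2].

Definition boxdel X s : box := [ffun j => [set i in X j | (i, j) != s]].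

Definition nonempty X : Prop := forall j, X j != set0.

Lemma mem_pts X i j : ((i, j) \in pts X) = (i \in X j).
Proof. by rewrite inE. Qed.

Lemma pts_inj : injective pts.
Proof.
by move=> X Y eqXY; apply/ffunP => j; apply/setP => i; rewrite -!mem_pts eqXY.
Qed.

Lemma pts_boxdel X s : pts (boxdel X s) = pts X :\ s.
Proof. by apply/setP => -[i j]; rewrite in_setD1 !mem_pts ffunE inE andbC. Qed.

Lemma boxface_pts X Y : boxface Y X = (pts Y \subset pts X).
Proof.
apply/forallP/subsetP => [sYX [i j]|sYX j]; first by rewrite !mem_pts;
  apply/subsetP.
by apply/subsetP => i; rewrite -!mem_pts; apply: sYX.
Qed.

Lemma card_pts X : #|pts X| = (\sum_j #|X j|)%N.
Proof.
rewrite -sum1_card (eq_bigl (fun s => true && (s.1 \in X s.2))); last first.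
  by move=> s; rewrite inE.
rewrite -(pair_big_dep xpredT (fun i j => i \in X j) (fun _ _ => 1%N)) /=.
by rewrite (exchange_big_dep xpredT) //=; apply: eq_bigr => j _;
  rewrite sum1_card.
Qed.

Lemma boxdim_pts X : nonempty X -> #|pts X| = (boxdim X + e)%N.
Proof.
move=> X_n0; rewrite card_pts -[X in (_ + X)%N]card_ord -sum1_card -big_split
  /=.
by apply: eq_bigr => j _; rewrite addn1 prednK // card_gt0.
Qed.

(** By [boxdim_pts] the drop in dimension is the number of points lost. *)
Lemma boxfacetP X Y : nonempty X -> nonempty Y -> boxfacet Y X ->
  exists2 s, s \in pts X & Y = boxdel X s.
Proof.
move=> X_n0 Y_n0 /andP[]; rewrite boxface_pts => sYX /eqP dimX.
have /cards1P[s defs] : #|pts X :\: pts Y| == 1%N.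
  by rewrite cardsDS // !boxdim_pts // dimX addSn subSnn.
have /setDP[sX sNY]: s \in pts X :\: pts Y by rewrite defs set11.
exists s => //; apply: pts_inj; rewrite pts_boxdel -defs.
by rewrite setDDr setDv set0U; apply/esym/setIidPr.
Qed.

Lemma boxfacet_boxdel X s : nonempty X -> nonempty (boxdel X s) ->
  s \in pts X -> boxfacet (boxdel X s) X.
Proof.
move=> X_n0 Xs_n0 sX; rewrite /boxfacet boxface_pts pts_boxdel subsetDl /=.
rewrite -(eqn_add2r e) addSn -!boxdim_pts // pts_boxdel.
by rewrite (cardsD1 s (pts X)) sX.
Qed.

Lemma nonempty_boxdel X s : nonempty X -> s \in pts X ->
  nonempty (boxdel X s) <-> (1 < #|X s.2|)%N.
Proof.
case: s => i j X_n0; rewrite mem_pts /= => iX.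
have X'j : boxdel X (i, j) j = X j :\ i.
  by rewrite ffunE; apply/setP => k; rewrite !inE xpair_eqE eqxx andbT andbC.
rewrite (cardsD1 i (X j)) iX add1n ltnS card_gt0 -X'j; split=> [|X'_n0 k];
  first exact.
case: (eqVneq k j) => [->//|ne_kj]; rewrite ffunE.
have /set0Pn[l lX] := X_n0 k; apply/set0Pn; exists l.
by rewrite inE lX xpair_eqE negb_and ne_kj orbT.
Qed.

Lemma eq_boxdel X s t : s \in pts X -> boxdel X s = boxdel X t -> s = t.
Proof.
move=> sX /(congr1 pts)/setP/(_ s); rewrite !pts_boxdel !in_setD1 eqxx sX
  !andbT /=.
by move/esym/negbFE/eqP.
Qed.

Definition slt s t : bool := (s.2 < t.2)%N || (s.2 == t.2) && (s.1 < t.1)%N.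

Lemma slt_total s t : s != t -> slt s t (+) slt t s.
Proof.
case: s t => [i j] [i' j']; rewrite xpair_eqE /slt /=.
rewrite -!(inj_eq val_inj) /=.
by case: (ltngtP j j'); case: (ltngtP i i').
Qed.

(* Modulo 2, this is the exponent of the usual incidence number of a product *)
(* of simplices, up to a global sign: a column [X k] with [k < s.2] should    *)
(* count for its dimension [#|X k| - 1] rather than for [#|X k|]; hence the   *)
(* summand [s.2].                                                             *)
Definition bpos X s : nat := (#|[set t in pts X | slt t s]| + s.2).+1.

Definition bsign X s : int := (-1) ^+ bpos X s.

Lemma bpos_del X s t : s \in pts X ->
  bpos X t = (bpos (boxdel X s) t + slt s t)%N.
Proof.
move=> sX; rewrite /bpos (cardsD1 s) [s \in [set _ in _ | _]]inE sX addSn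
  -addnA addnC.
congr (_ + _ + _).+1%N; apply: eq_card => u.
by rewrite pts_boxdel !inE andbA.
Qed.

(** Exactly one of the two removals shifts the position of the other point, so the two products have
    opposite signs. *)
Lemma bsign_del2 X s t : s \in pts X -> t \in pts X -> s != t ->
  bsign X s * bsign (boxdel X s) t + bsign X t * bsign (boxdel X t) s = 0.
Proof.
move=> sX tX ne_st; rewrite /bsign (bpos_del s tX) (bpos_del t sX) !exprD.
have := slt_total ne_st; case: (slt s t); case: (slt t s) => //= _.
  by rewrite expr0 expr1 !mulr1 mulrN1 mulNr mulrC addrN.
by rewrite expr0 expr1 !mulr1 mulrN1 mulNr mulrC addNr.
Qed.

(** For a facet of a box, both with nonempty columns, the product has the single factor of the
    removed point, which thus need not be chosen. *)
Definition binc X Y : int :=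
  if boxfacet Y X then \prod_(s in pts X :\: pts Y) bsign X s else 0.

Lemma binc_del X s : boxfacet (boxdel X s) X -> s \in pts X ->
  binc X (boxdel X s) = bsign X s.
Proof.
move=> facXs sX; rewrite /binc facXs pts_boxdel setDDr setDv set0U.
by rewrite (setIidPr _) ?sub1set // big_set1.
Qed.

Lemma edge_col X s t : boxdim X = 1%N -> (1 < #|X s.2|)%N -> (1 < #|X t.2|)%N ->
  s.2 = t.2.
Proof.
move=> dimX lt_s lt_t; apply/eqP/negPn/negP => ne_st; move: dimX.
rewrite /boxdim (bigD1 s.2) //= (bigD1 t.2) 1?eq_sym //=.
case: #|_| lt_s => [|[|?]] // _; case: #|_| lt_t => [|[|?]] // _.
by rewrite /= !addSn addnS.
Qed.

(** Both points form the only column with two elements, so they are neighbours for [slt] and their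
    positions differ by one. *)
Lemma bsign_edge X s t : boxdim X = 1%N -> s \in pts X -> t \in pts X ->
  s != t -> (1 < #|X s.2|)%N -> (1 < #|X t.2|)%N -> bsign X s + bsign X t = 0.
Proof.
move=> dimX; wlog: s t / slt s t.
  move=> IH sX tX ne_st lt_s lt_t; have := slt_total ne_st.
  case: (boolP (slt s t)) => [st _|_ /= ts]; first exact: IH.
  by rewrite addrC; apply: IH; rewrite 1?eq_sym.
move=> st sX tX ne_st lt_s lt_t; have eq2 := edge_col dimX lt_s lt_t.
have Xj : X s.2 = [set s.1; t.1].
  apply/esym/eqP; rewrite eqEcard subUset !sub1set cards2.
  rewrite -!mem_pts {2}eq2 -!surjective_pairing sX tX /=.
  have -> : s.1 != t.1.
    by apply: contraNneq ne_st => eq1;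
      rewrite [s]surjective_pairing eq1 eq2 -surjective_pairing.
  move: dimX; rewrite /boxdim (bigD1 s.2) //=.
  by case: #|_| => [|[|[|?]]].
rewrite /bsign; have -> : bpos X t = (bpos X s).+1; last first.
  by rewrite exprS mulN1r addrN.
rewrite /bpos eq2 -[in RHS]addSn; congr (_ + _).+1%N.
rewrite (cardsD1 s) [s \in [set _ in _ | _]]inE sX st add1n; congr _.+1.
apply: eq_card => u; rewrite !inE; case uX: (u.1 \in X u.2); rewrite ?andbF //=.
rewrite /slt eq2 -!(inj_eq val_inj) /=; case: ltngtP => //=; rewrite ?andbT.
- by move=> lt_u; apply: contraTneq lt_u => ->; rewrite eq2 ltnn.
- by rewrite andbF.
move/val_inj => equ; move: uX; rewrite equ -eq2 Xj !inE.
move: st; rewrite /slt eq2 ltnn eqxx /= => lt_st.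
have -> : (u == s) = (u.1 == s.1).
  by rewrite [u]surjective_pairing [s]surjective_pairing xpair_eqE /= equ eq2
    eqxx andbT.
by case/orP=> /eqP ->; rewrite ?eqxx ?ltnn ?andbF // ltnNge ltnW.
Qed.

End Points.

(** * The incidence axioms *)

Section Cells.
Variables (K : fieldType) (n d e : nat) (hed : (e <= d)%N).
Variables (I : {pred {mpoly K[n]}}).
Local Notation box := {ffun 'I_e -> {set 'I_n}}.
Implicit Types (X Y Z : box) (a : 'I_e -> 'I_n).
Implicit Types (s t : 'I_n * 'I_e) (F : {set 'I_n * 'I_e}).

Lemma cell_nonempty X : is_cell I X -> nonempty X.
Proof. by case/and3P=> /forallP. Qed.

Lemma face_cell X Y : is_cell I X -> boxface Y X -> nonempty Y -> is_cell I Y.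
Proof.
case/and3P=> _ /forallP leX /forallP inX /forallP sYX /forallP Y_n0.
rewrite /is_cell Y_n0 /=; apply/andP; split.
  apply/forallP => j; apply/forallP => k; apply/implyP => eq_jk.
  apply/forall_inP => i /(subsetP (sYX j)) iX;
    apply/forall_inP => l /(subsetP (sYX k)) lX.
  by have /forallP/(_ k)/implyP/(_ eq_jk)/forall_inP/(_ i iX)/forall_inP/(_ l
    lX) := leX j.
apply/forallP => f; apply/implyP => /forallP fY; apply: (implyP (inX f)).
by apply/forallP => j; apply: (subsetP (sYX j)).
Qed.

Lemma binc_incidence : is_incidence I (@binc n e).
Proof.
split=> [X Y /cell_nonempty X0 /cell_nonempty Y0|X Y /cell_nonempty X0
  /cell_nonempty Y0||].
- case: (boolP (boxfacet Y X)) => [facY|/negbTE]; last by rewrite /binc => ->.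
  have [s sX defY] := boxfacetP X0 Y0 facY; rewrite defY in facY *.
  by rewrite binc_del // /bsign -signr_odd; case: (odd _).
- case: (boolP (boxfacet Y X)) => [facY|/negbTE]; last by rewrite /binc => ->.
  have [s sX defY] := boxfacetP X0 Y0 facY; rewrite defY in facY *.
  by rewrite binc_del // /bsign signr_eq0.
- move=> X Y1 Y2 /cell_nonempty X0 /cell_nonempty Y10 /cell_nonempty Y20 dimX.
  move=> ne_Y fac1 fac2; have [s sX def1] := boxfacetP X0 Y10 fac1.
  have [t tX def2] := boxfacetP X0 Y20 fac2;
    rewrite {}def1 {}def2 in Y10 Y20 ne_Y fac1 fac2 *.
  rewrite !binc_del //; apply: bsign_edge => //; try exact/nonempty_boxdel.
  by apply: contraNneq ne_Y => ->.
move=> X Y1 Y2 Z /cell_nonempty X0 /cell_nonempty Y10 /cell_nonempty Y20.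
move=> /cell_nonempty Z0 ne_Y fac1 fac2 facZ1 facZ2.
have [s sX def1] := boxfacetP X0 Y10 fac1.
have [t tX def2] := boxfacetP X0 Y20 fac2.
rewrite {}def1 {}def2 in Y10 Y20 ne_Y fac1 fac2 facZ1 facZ2 *.
have ne_st : s != t by apply: contraNneq ne_Y => ->.
have [s' + defZ1] := boxfacetP Y10 Z0 facZ1.
have [t' + defZ2] := boxfacetP Y20 Z0 facZ2.
rewrite !pts_boxdel => t'X s'X.
(* Both chains of facets end in [Z], so they remove the same two points in opposite orders. *)
have ptsZ : pts X :\ s :\ s' = pts X :\ t :\ t'.
  by rewrite -!pts_boxdel -defZ1 -defZ2.
have def_s' : s' = t.
  have /setP/(_ t) := ptsZ; rewrite !in_setD1 eqxx andbF tX (eq_sym t s) ne_st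
    !andbT.
  by move/negbFE/eqP.
have def_t' : t' = s.
  have /setP/(_ s) := ptsZ; rewrite !in_setD1 eqxx andbF sX ne_st !andbT.
  by move/esym/negbFE/eqP.
rewrite {}def_s' {}def_t' in s'X t'X defZ1 defZ2.
rewrite !binc_del // {1}defZ1 defZ2 !binc_del ?pts_boxdel -?defZ1 -?defZ2 //.
exact: bsign_del2.
Qed.

End Cells.

(** * Cells and admissible pairs *)

Lemma big_setU_disjoint (R : Type) (idx : R) (op : Monoid.com_law idx)
    (T : finType) (A B : {set T}) (H : T -> R) : [disjoint A & B] ->
  \big[op/idx]_(i in A :|: B) H i =
    op (\big[op/idx]_(i in A) H i) (\big[op/idx]_(i in B) H i).
Proof. by move=> dAB; rewrite -bigU //=; apply: eq_bigl => i; rewrite !inE. Qed.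

Section Graph.
Variables n e : nat.
Implicit Types (a : 'I_e -> 'I_n) (s t : 'I_n * 'I_e).

Definition graph a : {set 'I_n * 'I_e} := [set (a j, j) | j in 'I_e].

Lemma mem_graph a s : (s \in graph a) = (s.1 == a s.2).
Proof.
apply/imsetP/eqP => [[j _ ->]//|eq_s].
by exists s.2; rewrite // -eq_s -surjective_pairing.
Qed.

Lemma wpos_notin_graph a s : wpos a s -> s \notin graph a.
Proof. by case/andP=> lt_s _; rewrite mem_graph; apply: contraTneq lt_s => ->;
  rewrite ltnn. Qed.

Lemma big_graph R (idx : R) (op : Monoid.com_law idx) a (H : 'I_n * 'I_e -> R) :
  \big[op/idx]_(s in graph a) H s = \big[op/idx]_j H (a j, j).
Proof. by rewrite big_imset //= => j k _ _ []. Qed.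

Lemma card_graph a : #|graph a| = e.
Proof. by rewrite card_imset ?card_ord // => j k []. Qed.

End Graph.

Section WordCells.
Variables (K : fieldType) (n d e : nat) (hed : (e <= d)%N).
Variables (I : {pred {mpoly K[n]}}).
Hypotheses (hI : borel_fixed I) (hdeg : generated_in_degree I e).
Local Notation box := {ffun 'I_e -> {set 'I_n}}.
Implicit Types (X Y : box) (a : 'I_e -> 'I_n).
Implicit Types (s t : 'I_n * 'I_e) (F : {set 'I_n * 'I_e}).

Definition wadm a F : Prop :=
  [/\ nondecr a, mingen I (wmon a) & forall s, s \in F -> wpos a s].

Definition wbox a F : box := box_of hed (wid hed @: F) (wmon a).

Lemma pts_wbox a F : wadm a F -> pts (wbox a F) = F :|: graph a.
Proof.
by case=> a_nd _ _; apply/setP => -[i j];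
  rewrite mem_pts mem_box_of // in_setU mem_graph.
Qed.

Lemma wadm_disjoint a F : wadm a F -> [disjoint F & graph a].
Proof.
case=> _ _ posF; rewrite disjoint_subset; apply/subsetP => s /posF.
exact: wpos_notin_graph.
Qed.

Lemma wadm_last a F i j : wadm a F -> i \in wbox a F j -> (i <= a j)%N.
Proof.
move=> wF; have [a_nd _ posF] := wF; rewrite mem_box_of // => /orP[|/eqP-> //].
by case/posF/andP=> /ltnW.
Qed.

Lemma wadm_first a F i (j k : 'I_e) : wadm a F ->
  i \in wbox a F j -> (k < j)%N -> (a k <= i)%N.
Proof.
move=> wF; have [a_nd _ posF] := wF; rewrite mem_box_of // => /orP[|/eqP->].
  by case/posF/andP=> _ /forallP/(_ k)/implyP; apply.
by move/ltnW/a_nd.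
Qed.

Lemma last_wbox a F j : wadm a F -> a j \in wbox a F j.
Proof. by case=> a_nd _ _; rewrite mem_box_of // eqxx orbT. Qed.

Lemma wbox_cell a F : wadm a F -> is_cell I (wbox a F).
Proof.
move=> wF; have [a_nd gen_a posF] := wF; apply/and3P; split.
- by apply/forallP => j; apply/set0Pn; exists (a j); apply: last_wbox.
- apply/forallP => j; apply/forallP => k; apply/implyP => /eqP eq_jk.
  apply/forall_inP => i iX; apply/forall_inP => l lX.
  by apply: leq_trans (wadm_last wF iX) (wadm_first wF lX _); rewrite -eq_jk.
apply/forallP => f; apply/implyP => /forallP fX.
apply: (@borel_wmon _ _ _ _ hI hdeg a) => [|j]; last exact: wadm_last (fX j).
by case/andP: gen_a.
Qed.

Lemma wbox_dim a F : wadm a F -> boxdim (wbox a F) = #|F|.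
Proof.
move=> wF; apply: (@addIn e).
rewrite -boxdim_pts; last exact: cell_nonempty (wbox_cell wF).
by rewrite pts_wbox // cardsU disjoint_setI0 ?wadm_disjoint // cards0 subn0
  card_graph.
Qed.

Lemma is_cell_word X : is_cell I X ->
  exists a, exists2 F, wadm a F & X = wbox a F.
Proof.
case/and3P=> /forallP X0 /forallP leX /forallP inX.
have maxX (j : 'I_e) : {i | i \in X j & forall k, k \in X j -> (k <= i)%N}.
  have [i0 i0X] := sigW (set0Pn _ (X0 j)).
  by case: (arg_maxnP (fun i : 'I_n => i : nat) i0X) => i; exists i.
pose a j := s2val (maxX j).
have aX j : a j \in X j by rewrite /a; case: (maxX j).
have leaX j i : i \in X j -> (i <= a j)%N by rewrite /a;
  case: (maxX j) => ? ? /=; apply.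
(* Cells compare adjacent columns only; the bound is passed on through the maxima of the columns in
   between, which exist as no column is empty. *)
have lastX (j k : 'I_e) i : (j < k)%N -> i \in X k -> (a j <= i)%N.
  case: k i => k; elim: k => // k IHk lt_k i /=;
    rewrite ltnS leq_eqVlt => le_jk iX.
  have lt_k' : (k < e)%N by apply: ltnW.
  have step l : l \in X (Ordinal lt_k') -> (l <= i)%N.
    move=> lX; have /forallP/(_ (Ordinal lt_k)) := leX (Ordinal lt_k').
    by rewrite eqxx => /forall_inP/(_ l lX)/forall_inP/(_ i iX).
  case/orP: le_jk => [/eqP eq_jk|lt_jk].
    by apply: step; have <- : j = Ordinal lt_k' by apply: val_inj.
  by apply: leq_trans (step _ (aX _)); apply: IHk.
have a_nd : nondecr a.
  move=> j k; rewrite leq_eqVlt => /orP[/eqP/val_inj-> //|lt_jk].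
  exact: lastX (aX k).
have wX : wadm a (pts X :\: graph a).
  split=> //.
    rewrite (mingenE hdeg) mdeg_wmon eqxx andbT.
    rewrite -(@eq_wmon _ _ (finfun a) a) => [|j]; last by rewrite ffunE.
    by apply: (implyP (inX (finfun a))); apply/forallP => j; rewrite ffunE.
  move=> [i j]; rewrite inE mem_graph mem_pts /= => /andP[ne_i iX].
  rewrite /wpos /= ltn_neqAle (inj_eq val_inj) ne_i leaX //=.
  by apply/forallP => k; apply/implyP => lt_k; apply: lastX iX.
exists a; exists (pts X :\: graph a) => //; apply: pts_inj; rewrite pts_wbox //.
apply/setP => -[i j]; rewrite in_setU in_setD mem_pts mem_graph /=.
by case: eqP => [->|]; rewrite ?aX ?orbT ?orbF.
Qed.

(** The letter [a j] is recovered as the maximum of column [j], and then [F] as the complement of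
    the graph of [a]. *)
Lemma wbox_inj a F b G : wadm a F -> wadm b G -> wbox a F = wbox b G ->
  a =1 b /\ F = G.
Proof.
move=> wF wG eqX.
have eq_ab : a =1 b.
  move=> j; apply/val_inj/anti_leq/andP; split.
    by apply: (wadm_last wG); rewrite -eqX last_wbox.
  by apply: (wadm_last wF); rewrite eqX last_wbox.
have eq_gr : graph a = graph b by apply/setP => s; rewrite !mem_graph eq_ab.
have setK c H : wadm c H -> pts (wbox c H) :\: graph c = H.
  move=> wH; rewrite pts_wbox // setDUl setDv setU0.
  exact/setDidPl/wadm_disjoint.
by rewrite -(setK _ _ wF) -(setK _ _ wG) eqX eq_gr.
Qed.

Lemma boxlabel_pts X :
  boxlabel hed X = (\sum_(s in pts X) U_(xvar (wid hed s)))%MM.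
Proof.
rewrite (eq_bigl (fun s => true && (s.1 \in X s.2))); last first.
  by move=> s; rewrite inE.
rewrite -(pair_big_dep xpredT (fun i j => i \in X j)
            (fun i j => U_(xvar (wid hed (i, j))))%MM) /=.
by rewrite (exchange_big_dep xpredT).
Qed.

Lemma boxlabel_wbox a F : wadm a F ->
  boxlabel hed (wbox a F) = admdeg (wid hed @: F) (wmon a).
Proof.
move=> wF; have [a_nd _ _] := wF; rewrite boxlabel_pts pts_wbox //.
rewrite big_setU_disjoint ?wadm_disjoint // big_graph /admdeg -bpol_wmon //
  addmC.
by rewrite (big_imset _ (in2W (@wid_inj _ _ _ hed))).
Qed.

Lemma boxlabel_del X s : s \in pts X ->
  (boxlabel hed X - boxlabel hed (boxdel X s))%MM = U_(xvar (wid hed s))%MM.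
Proof.
move=> sX; rewrite !boxlabel_pts pts_boxdel (big_setD1 s sX) /=.
by rewrite addmK.
Qed.

(* [wid @: wlast F] is the set [B(F, m)]. *)
Definition wlast F : {set 'I_n * 'I_e} :=
  [set s in F | [forall t in F, (t.2 == s.2) ==> (t.1 <= s.1)%N]].

Lemma bset_wlast a F : wadm a F ->
  bset I (wid hed @: F) (wmon a) = wid hed @: wlast F.
Proof.
case=> a_nd gen_a posF; apply/setP => u; apply/idP/imsetP => [uB|[s + ->]].
  have /setIdP[/imsetP[s sF def_u] _] := uB; exists s => //.
  by rewrite inE -(mem_bset hed hI hdeg _ a_nd) // -def_u.
by rewrite inE -(mem_bset hed hI hdeg _ a_nd).
Qed.

Lemma col_gt1 a F s : wadm a F -> s \in F -> (1 < #|wbox a F s.2|)%N.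
Proof.
move=> wF sF; have [a_nd _ posF] := wF; have /andP[lt_s _] := posF s sF.
rewrite (cardsD1 (a s.2)) last_wbox // add1n ltnS card_gt0; apply/set0Pn;
  exists s.1.
rewrite in_setD1 mem_box_of // -surjective_pairing sF andbT.
by apply: contraTneq lt_s => ->; rewrite ltnn.
Qed.

(** A column with at least two points contains a point of [F]; its largest one, in [wlast F], serves
    as the index of the column top. *)
Lemma removable_wbox a F : wadm a F ->
  [set s in pts (wbox a F) | (1 < #|wbox a F s.2|)%N] =
    F :|: [set (a s.2, s.2) | s in wlast F].
Proof.
move=> wF; have [a_nd _ posF] := wF; apply/setP => -[i j].
rewrite inE mem_pts /= mem_box_of // in_setU.
case ijF: ((i, j) \in F) => /=; first exact: (col_gt1 wF ijF).
apply/andP/imsetP => [[/eqP-> lt_j]|[s]]; last first.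
  by rewrite inE => /andP[sF _] [-> ->]; rewrite eqxx (col_gt1 wF sF).
have [i0 i0F] : exists i0, (i0, j) \in F.
  move: lt_j; rewrite (cardsD1 (a j)) last_wbox // add1n ltnS card_gt0 =>
    /set0Pn[i0].
  by rewrite in_setD1 mem_box_of // => /andP[/negPf->]; rewrite orbF; exists i0.
have [i1 i1F max_i1] := @arg_maxnP _ i0 (fun i => (i, j) \in F) (fun i : 'I_n
  => i : nat) i0F.
exists (i1, j) => //; rewrite inE i1F; apply/forall_inP => -[l k] lkF.
by apply/implyP => /= /eqP eq_kj; apply: max_i1; rewrite -eq_kj.
Qed.

Lemma wadm_del a F s : wadm a F -> wadm a (F :\ s).
Proof. by case=> a_nd gen_a posF; split=> // t /setD1P[_ /posF]. Qed.

Lemma wbox_del a F s : wadm a F -> s \in F ->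
  boxdel (wbox a F) s = wbox a (F :\ s).
Proof.
move=> wF sF; have [_ _ posF] := wF; apply: pts_inj.
rewrite pts_boxdel !pts_wbox //; last exact: wadm_del.
rewrite setDUl; congr (_ :|: _); apply/setDidPl.
by rewrite disjoint_sym disjoints1 wpos_notin_graph ?posF.
Qed.

Lemma wadm_upd a F s : wadm a F -> s \in wlast F -> wadm (wupd a s) (F :\ s).
Proof.
case=> a_nd gen_a posF /setIdP[sF /forall_inP max_s]; have s_pos := posF s sF.
split=> [||t /setD1P[ne_t tF]]; [exact: wupd_nondecr | exact: (mingen_upd hI
  hdeg) |].
rewrite wpos_upd ?posF //; apply/implyP => eq2.
rewrite ltn_neqAle (implyP (max_s t tF) eq2) andbT (inj_eq val_inj).
apply: contra ne_t => eq1; rewrite [s]surjective_pairing [t]surjective_pairing.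
by rewrite xpair_eqE eq1.
Qed.

(** The new letter [s.1] is already a point of the column: it merely moves from [F] to the word,
    while the old letter disappears. *)
Lemma wbox_upd a F s : wadm a F -> s \in wlast F ->
  boxdel (wbox a F) (a s.2, s.2) = wbox (wupd a s) (F :\ s).
Proof.
move=> wF sB; have [_ _ posF] := wF; have /setIdP[sF _] := sB.
apply: pts_inj; rewrite pts_boxdel !pts_wbox //; last exact: wadm_upd.
apply/setP => -[i j]; rewrite in_setD1 !in_setU in_setD1 !mem_graph /= /wupd.
case: s sF {sB} => k l /= sF; rewrite !xpair_eqE.
case: (eqVneq j l) => [->|_]; last by rewrite !andbF.
rewrite !andbT; have [->|ne_ik] := eqVneq i k.
  rewrite sF orbT andbT; have /wpos_notin_graph := posF _ sF.
  by rewrite mem_graph.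
case: (eqVneq i (a l)) => [->|_]; last by rewrite !orbF.
rewrite /= orbF; apply/esym/negbTE/negP => /posF/wpos_notin_graph.
by rewrite mem_graph eqxx.
Qed.

(** [frank] orders by first coordinates, which on [F] agrees with the order by columns: a point of
    an earlier column is smaller than the letter of that column, hence than [s.1]. The other points
    before [s] are the [s.2] letters of earlier columns; with the summand [s.2] in [bpos] they
    contribute an even number. *)
Lemma bpos_wbox a F s : wadm a F -> s \in F ->
  bpos (wbox a F) s = (frank (wid hed @: F) (wid hed s) + (s.2).*2)%N.
Proof.
move=> wF sF; have [a_nd _ posF] := wF;
  have /andP[lt_s /forallP le_s] := posF s sF.
have -> : frank (wid hed @: F) (wid hed s) = #|s |: [set t in F | slt t s]|.
  rewrite /frank -(card_imset _ (@wid_inj _ _ _ hed)).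
  congr #|pred_of_set _|; apply/setP => u;
    apply/setIdP/imsetP => [[/imsetP[t tF ->]]|[t]].
    move=> le_ts; exists t => //; rewrite !inE tF.
    have /andP[lt_t /forallP le_t] := posF t tF; case: eqVneq => //= ne_ts.
    rewrite /slt -(inj_eq val_inj); case: ltngtP => //= [lt_st|/val_inj eq2].
      (* A point of a later column would satisfy s.1 < a s.2 <= t.1, against [le_ts]. *)
      have := leq_trans lt_s (implyP (le_t s.2) lt_st).
      by rewrite ltnNge; move: le_ts => /= ->.
    rewrite ltn_neqAle; move: le_ts => /= ->; rewrite andbT (inj_eq val_inj).
    by apply: contraNneq ne_ts => eq1;
      rewrite [t]surjective_pairing eq1 eq2 -surjective_pairing.
  move=> + ->; rewrite !inE => /orP[/eqP->|/andP[tF lt_ts]];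
    first by rewrite imset_f.
  rewrite imset_f //; split=> //=; case/orP: lt_ts => [lt2|/andP[_ /ltnW //]].
  apply: leq_trans (implyP (le_s t.2) lt2).
  by case/andP: (posF t tF) => /ltnW.
rewrite cardsU1 !inE sF /slt !ltnn andbF add1n addSn -addnn addnA;
  congr (_ + _).+1%N.
have -> : [set t in pts (wbox a F) | slt t s] =
    [set t in F | slt t s] :|: [set (a k, k) | k in [set k : 'I_e | (k <
      s.2)%N]].
  apply/setP => t; rewrite pts_wbox // !inE mem_graph andb_orl; congr (_ || _).
  apply/andP/imsetP => [[/eqP eq_t lt_ts]|[k + ->]].
    exists t.2; last by rewrite -eq_t -surjective_pairing.
    rewrite inE; case/orP: lt_ts => // /andP[/eqP eq2].
    by rewrite eq_t eq2 ltnNge ltnW.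
  by rewrite inE /slt eqxx => ->.
rewrite cardsU disjoint_setI0 ?cards0 ?subn0.
  by rewrite card_imset ?card_ord_lt 1?ltnW // => j k [].
rewrite disjoint_subset; apply/subsetP => t /setIdP[/posF/wpos_notin_graph + _].
by apply: contra => /imsetP[k _ ->]; rewrite mem_graph.
Qed.

(** As [s] is the largest point of [F] in its column, no point of the box lies between it and the
    column top. *)
Lemma bpos_last a F s : wadm a F -> s \in wlast F ->
  bpos (wbox a F) (a s.2, s.2) = (bpos (wbox a F) s).+1.
Proof.
move=> wF /setIdP[sF /forall_inP max_s]; have [a_nd _ posF] := wF.
have /andP[lt_s _] := posF s sF.
rewrite /bpos -[in RHS]addSn; congr (_ + _).+1%N.
rewrite (cardsD1 s) [s \in [set _ in _ | _]]inE pts_wbox // in_setU sF /=.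
rewrite {1}/slt eqxx lt_s orbT add1n; congr _.+1; apply: eq_card => t.
rewrite in_setD1 [in LHS]inE [in RHS]inE; case tX: (t \in _);
  rewrite ?andbF //=.
rewrite /slt /= -!(inj_eq val_inj); case: (ltngtP t.2 s.2) => //=
  [lt2|_|/val_inj eq2].
- by rewrite andbT; apply: contraTneq lt2 => ->; rewrite ltnn.
- by rewrite andbF.
have -> : (t == s) = (t.1 == s.1).
  by rewrite [t]surjective_pairing [s]surjective_pairing xpair_eqE /= eq2 eqxx
    andbT.
move: tX; rewrite in_setU mem_graph => /orP[tF|/eqP eq_t].
  have := implyP (max_s t tF); rewrite eq2 eqxx => /(_ isT) le_ts.
  by rewrite (leq_ltn_trans le_ts lt_s) andbT ltn_neqAle le_ts andbT.
by rewrite eq_t eq2 ltnn andbF ltnNge ltnW.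
Qed.

(** The two polarizations differ in one column only, so the coefficient in the second sum is the
    variable of the removed column top. *)
Lemma bpol_upd a s : nondecr a -> wpos a s ->
  (U_(xvar (wid hed s)) + bpol d (wmon a) - bpol d (wmon (wupd a s)))%MM =
    U_(xvar (wid hed (a s.2, s.2)))%MM.
Proof.
move=> a_nd s_pos; rewrite !(bpol_wmon hed) //; last exact: wupd_nondecr.
rewrite (bigD1 s.2) //= [X in (_ - X)%MM](bigD1 s.2) //=.
rewrite {1}/wupd eqxx -surjective_pairing.
rewrite [X in (_ - (_ + X))%MM](eq_bigr (fun j => U_(xvar (wid hed (a j,
  j))))%MM).
  by rewrite addmA [(U_(_) + U_(_))%MM]addmC -addmA addmK.
by move=> j /negPf ne_j; rewrite /wupd ne_j.
Qed.

End WordCells.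

(** * The isomorphism of complexes *)

Section LinearExtension.
Variable R : comNzRingType.

Lemma linext_fbasis (B : finType) (M : lmodType R) (f : B -> M) b :
  linext f (fbasis R b) = f b.
Proof.
rewrite /linext (bigD1 b) //= ffunE eqxx scale1r big1 ?addr0 // => c /negPf
  ne_c.
by rewrite ffunE ne_c scale0r.
Qed.

Lemma linext_comp (B C : finType) (M : lmodType R) (f : C -> M)
    (g : B -> freemod R C) v :
  linext f (linext g v) = linext (fun b => linext f (g b)) v.
Proof.
rewrite {2}/linext linear_sum [RHS]/linext.
by apply: eq_bigr => b _; rewrite linearZ.
Qed.

Lemma eq_linext (B : finType) (M : lmodType R) (f g : B -> M) : f =1 g ->
  linext f =1 linext g.
Proof. by move=> eq_fg v; apply: eq_bigr => b _; rewrite eq_fg. Qed.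

Lemma linext_diff (B T : finType) (M : lmodType R) (f : B -> M) (A A' : {set T})
    (c c' : T -> R) (u u' : T -> freemod R B) :
  linext f (\sum_(t in A) c t *: u t - \sum_(t in A') c' t *: u' t) =
    \sum_(t in A) c t *: linext f (u t)
      - \sum_(t in A') c' t *: linext f (u' t).
Proof.
by rewrite linearB; congr (_ - _); rewrite linear_sum; apply: eq_bigr => t _;
  rewrite linearZ.
Qed.

End LinearExtension.

Lemma inj_surj_bij (A : choiceType) (B : eqType) (f : A -> B) :
  injective f -> (forall b, exists a, f a == b) -> bijective f.
Proof.
move=> f_inj f_surj; pose g b := xchoose (f_surj b).
have gK : cancel g f by move=> b; apply/eqP/(xchooseP (f_surj b)).
by exists g => // a; apply: f_inj.
Qed.

(** * Comparison of bases, differentials and augmentations *)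

Section Isomorphism.
Variables (K : fieldType) (n d e : nat) (hed : (e <= d)%N).
Variables (I : {pred {mpoly K[n]}}).
Hypotheses (hI : borel_fixed I) (hdeg : generated_in_degree I e).
Local Notation box := {ffun 'I_e -> {set 'I_n}}.
Local Notation Spol := {mpoly K[n * d]}.
Implicit Types (X Y : box) (a : 'I_e -> 'I_n).
Implicit Types (s t : 'I_n * 'I_e) (F : {set 'I_n * 'I_e}).

Lemma adm_word q (p : adm d I q) :
  exists a, exists2 F, wadm I a F &
    [/\ (val p).1 = wid hed @: F, bmnm (val p).2 = wmon a & #|F| = q].
Proof.
case: p => -[F0 m] /= /andP[admF /eqP cardF].
have [a [F [a_nd def_m] [def_F gen_a posF]]] := admissibleP hed hdeg admF.
exists a; exists F => //; split=> //.
by rewrite -cardF def_F card_imset //; apply: wid_inj.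
Qed.

Lemma word_adm q a F : wadm I a F -> #|F| = q -> exists p : adm d I q,
  (val p).1 = wid hed @: F /\ bmnm (val p).2 = wmon a.
Proof.
case=> a_nd gen_a posF cardF.
have lt_deg : (mdeg (wmon a) < d.+1)%N by rewrite mdeg_wmon ltnS.
have admF : admissible I (wid hed @: F) (BMultinom lt_deg) &&
            (#|wid hed @: F| == q).
  rewrite admissible_wmon // gen_a card_imset ?cardF ?eqxx ?andbT;
    last exact: wid_inj.
  exact/forall_inP.
by exists (exist _ (wid hed @: F, BMultinom lt_deg) admF).
Qed.

Lemma adm_cell q (p : adm d I q) :
  is_cell I (box_of hed (val p).1 (val p).2) &&
    (boxdim (box_of hed (val p).1 (val p).2) == q).
Proof.
have [a [F wF [-> -> <-]]] := adm_word p.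
by rewrite -/(wbox hed a F) wbox_cell // (wbox_dim hed hI hdeg wF) /=.
Qed.

Definition cell_of q (p : adm d I q) : cell e I q :=
  exist _ (box_of hed (val p).1 (val p).2) (adm_cell p).

Lemma cell_of_inj q : injective (@cell_of q).
Proof.
move=> p p' /(congr1 val) /=.
have [a [F wF [def_F def_m _]]] := adm_word p.
have [b [G wG [def_G def_m' _]]] := adm_word p'.
rewrite def_F def_m def_G def_m' => /(wbox_inj wF wG)[eq_ab eq_FG].
apply: val_inj; case: (val p) (val p') def_F def_m def_G def_m' => F1 m1 [G1
  m1'] /=.
by move=> -> def_m -> def_m'; rewrite eq_FG; congr (_, _); apply: val_inj;
  rewrite /= def_m def_m' (eq_wmon eq_ab).
Qed.

Lemma cell_of_surj q (c : cell e I q) : exists p, cell_of p == c.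
Proof.
case: c => X cX; have /andP[/(is_cell_word hed hdeg)[a [F wF defX]] /eqP dimX]
  := cX.
have def_q : #|F| = q by rewrite -dimX defX (wbox_dim hed hI hdeg wF).
have [p [def_F def_m]] := word_adm wF def_q.
by exists p; rewrite -val_eqE /= def_F def_m defX.
Qed.

(** Defined for every box, and zero unless it is a [q]-cell, so that sums over points can be written
    without cell proofs. *)
Definition boxbasis q X : freemod Spol (cell e I q) :=
  [ffun c => (val c == X)%:R].

Lemma fbasis_boxbasis q (c : cell e I q) : fbasis Spol c = boxbasis q (val c).
Proof. by apply/ffunP => c'; rewrite !ffunE -(inj_eq val_inj). Qed.

Definition cellmap q : freemod Spol (adm d I q) -> freemod Spol (cell e I q) :=
  linext (fun p => fbasis Spol (cell_of p)).

Lemma cellmap_admbasis q a F : wadm I a F -> #|F| = q ->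
  cellmap (admbasis I q (wid hed @: F) (wmon a)) = boxbasis q (wbox hed a F).
Proof.
move=> wF cardF; have [p [def_F def_m]] := word_adm wF cardF.
have -> : admbasis I q (wid hed @: F) (wmon a) = fbasis Spol p.
  apply/ffunP => p'; rewrite !ffunE -[in RHS](inj_eq val_inj) -def_F -def_m.
  by case: (val p') (val p) => [F1 m1] [F2 m2].
by rewrite /cellmap linext_fbasis fbasis_boxbasis /= def_F def_m.
Qed.

Lemma diffC_basisE q (c : cell e I q.+1) :
  diffC_basis hed (@binc n e) c =
  \sum_(s in [set s in pts (val c) | (1 < #|val c s.2|)%N])
     ((bsign (val c) s)%:~R * 'X_(xvar (wid hed s)) : Spol)
       *: boxbasis q (boxdel (val c) s).
Proof.
case: c => X cX /=; have /andP[cellX /eqP dimX] := cX.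
have X0 := cell_nonempty cellX.
pose H Y := ((binc X Y)%:~R * 'X_[(boxlabel hed X - boxlabel hed Y)%MM] : Spol)
              *: boxbasis q Y.
rewrite /diffC_basis /= (eq_bigr (fun c' : cell e I q => H (val c')));
  last first.
  by move=> c' _; rewrite fbasis_boxbasis.
set A := [set s in _ | _].
transitivity (\sum_(s in A) H (boxdel X s)); last first.
  apply: eq_bigr => s /setIdP[sX lt_s]; rewrite /H (boxlabel_del hed sX).
  have Y0 : nonempty (boxdel X s) by apply/nonempty_boxdel.
  by rewrite (binc_del (boxfacet_boxdel X0 Y0 sX) sX).
have inj_del : {in A &, injective (boxdel X)}.
  by move=> s t /setIdP[sX _] _; apply: eq_boxdel.
(* Both sums become sums over boxes, whose index sets are then compared. *)
rewrite -(big_imset H inj_del) /=.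
rewrite -(big_imset H (A := [pred c' : cell e I q | boxfacet (val c') X]) (in2W
  val_inj)) /=.
apply: eq_bigl => Y; apply/imsetP/imsetP => [[c' facY ->]|[s /setIdP[sX lt_s]
  ->]].
  have /andP[cellY _] := valP c'.
  have Y0 := cell_nonempty cellY; have [s sX defY] := boxfacetP X0 Y0 facY.
  exists s => //; rewrite inE sX /=; apply/(nonempty_boxdel X0 sX).
  by rewrite -defY.
have Y0 : nonempty (boxdel X s) by apply/nonempty_boxdel.
have facY := boxfacet_boxdel X0 Y0 sX.
have cY : is_cell I (boxdel X s) && (boxdim (boxdel X s) == q).
  have /andP[faceY] := facY; rewrite dimX eqSS eq_sym => ->.
  by rewrite (face_cell cellX).
by exists (exist _ (boxdel X s) cY).
Qed.

Lemma bsign_wbox a F s : wadm I a F -> s \in F ->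
  bsign (wbox hed a F) s = (-1) ^+ frank (wid hed @: F) (wid hed s).
Proof.
move=> wF sF; rewrite /bsign (bpos_wbox hed wF sF).
by rewrite -signr_odd oddD odd_double addbF signr_odd.
Qed.

Lemma bsign_last a F s : wadm I a F -> s \in wlast F ->
  bsign (wbox hed a F) (a s.2, s.2) =
    - (-1) ^+ frank (wid hed @: F) (wid hed s).
Proof.
move=> wF sB; have /setIdP[sF _] := sB.
by rewrite -(bsign_wbox wF sF) /bsign (bpos_last hed wF sB) exprS mulN1r.
Qed.

Lemma cellmap_diffP_basis q (p : adm d I q.+1) :
  cellmap (diffP_basis p) = diffC_basis hed (@binc n e) (cell_of p).
Proof.
have [a [F wF [def_F def_m cardF]]] := adm_word p; have [a_nd gen_a posF] := wF.
rewrite diffC_basisE /= /diffP_basis def_F def_m -/(wbox hed a F).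
rewrite (removable_wbox hed wF) big_setU_disjoint; last first.
  rewrite disjoint_subset; apply/subsetP => s sF; rewrite inE.
  apply/imsetP => -[t _ def_s]; have := wpos_notin_graph (posF s sF).
  by rewrite def_s mem_graph eqxx.
rewrite /cellmap linext_diff (bset_wlast hed hI hdeg wF).
have card_del s : s \in F -> #|F :\ s| = q.
  by move=> sF; apply/eqP; rewrite -eqSS -cardF (cardsD1 s F) sF.
have last_inj : {in wlast F &, injective (fun s => (a s.2, s.2))}.
  move=> s t /setIdP[sF /forall_inP max_s] /setIdP[tF /forall_inP max_t] [_
    eq2].
  rewrite [s]surjective_pairing [t]surjective_pairing eq2; congr (_, _).
  apply/val_inj/anti_leq; have := max_s t tF; have := max_t s sF.
  by rewrite eq2 eqxx /= => -> ->.
(* Removing points of [F] gives the first sum, removing column tops the second, whose minus sign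
   comes from [bsign_last]. *)
congr (_ + _).
  rewrite big_imset; last exact: in2W (@wid_inj _ _ _ hed).
  apply: eq_bigr => s sF; rewrite -wid_imsetD1 (wbox_del hed wF sF).
  rewrite -/(cellmap _) (cellmap_admbasis (wadm_del s wF) (card_del s sF)).
  congr (_ *: _); congr (_ * _).
  by rewrite (bsign_wbox wF sF) rmorphXn rmorphN1.
rewrite -sumrN big_imset; last exact: in2W (@wid_inj _ _ _ hed).
rewrite (big_imset _ last_inj).
apply: eq_bigr => s sB; have /setIdP[sF _] := sB; have s_pos := posF s sF.
rewrite -wid_imsetD1 (mangle_wmon hI hdeg a_nd gen_a s_pos).
rewrite -/(cellmap _) (cellmap_admbasis (wadm_upd hI hdeg wF sB) (card_del s
  sF)).
rewrite (wbox_upd hed hI hdeg wF sB) (bpol_upd hed a_nd s_pos) -scaleNr;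
  congr (_ *: _).
rewrite -mulNr; congr (_ * _).
by rewrite (bsign_last wF sB) rmorphN rmorphXn rmorphN1.
Qed.

Lemma augC_cell (g : Spol) (c : cell e I 0) :
  augC hed (g *: fbasis Spol c) = g * 'X_[boxlabel hed (val c)].
Proof. by rewrite /augC linearZ /= linext_fbasis. Qed.

Lemma boxlabel_cell_of q (p : adm d I q) :
  boxlabel hed (val (cell_of p)) = admdeg (val p).1 (val p).2.
Proof.
have [a [F wF [def_F def_m _]]] := adm_word p.
by rewrite /= def_F def_m -/(wbox hed a F) (boxlabel_wbox hed wF).
Qed.

Lemma boxlabel_cell0 (p : adm d I 0) :
  boxlabel hed (val (cell_of p)) = bpol d (val p).2.
Proof.
rewrite boxlabel_cell_of /admdeg; case/andP: (valP p) => _ /eqP/cards0_eq ->.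
by rewrite big_set0 addm0.
Qed.

(** Vertices correspond to pairs with empty [F], and their labels are the polarized generators, so
    the image of the augmentation is the ideal they generate. *)
Lemma bpol_ideal_image (f : Spol) :
  bpol_ideal I f <-> exists v, augC (I := I) hed v = f.
Proof.
split=> [[s genS ->]|[v <-]].
  elim: s genS => [_|[g h] s IHs genS].
    by exists 0; rewrite big_nil /augC linear0.
  have [t ts|v def_v] := IHs; first by apply: genS; rewrite inE ts orbT.
  have [m gen_m /= ->] := genS (g, h) (mem_head _ _).
  have [a a_nd def_m] := wmonP (hdeg gen_m).
  have wm : wadm I a set0 by split=> [||t]; rewrite -?def_m ?inE.
  have [p [_ def_p]] := word_adm wm (cards0 _).
  exists (g *: fbasis Spol (cell_of p) + v).
  rewrite /augC linearD /= -/(augC hed _) -/(augC hed _) augC_cell def_v.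
  by rewrite boxlabel_cell0 def_p -def_m big_cons.
exists [seq (v c, 'X_[boxlabel hed (val c)]) | c <- index_enum (cell e I 0)].
  move=> _ /mapP[c _ ->] /=; have [p /eqP <-] := cell_of_surj c.
  exists (val p).2; last by rewrite boxlabel_cell0.
  by case/andP: (valP p) => /and4P[].
by rewrite big_map.
Qed.

End Isomorphism.

Theorem proposition4p9 (K : fieldType) (n d e : nat) (hed : (e <= d)%N)
    (I : {pred {mpoly K[n]}}) (hI : borel_fixed I)
    (hdeg : generated_in_degree I e) :
  exists phi : forall q, adm d I q -> cell e I q,
    [/\ forall q (p : adm d I q),
          val (phi q p) = box_of hed (val p).1 (val p).2,
        forall q, bijective (phi q)
      & exists2 inc : {ffun 'I_e -> {set 'I_n}} -> {ffun 'I_e -> {set 'I_n}}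
                        -> int,
          is_incidence I inc
        & let Phi q := linext (fun p => fbasis {mpoly K[n * d]} (phi q p)) in
          [/\ forall q (p : adm d I q),
                 boxlabel hed (val (phi q p)) = admdeg (val p).1 (val p).2,
               forall q v, diffC hed inc (Phi q.+1 v) = Phi q (diffP v),
               forall v, augC hed (Phi 0%N v) = augP v
             & forall f : {mpoly K[n * d]},
                 bpol_ideal I f <-> exists v, augC (I := I) hed v = f]].
Proof.
exists (cell_of hed hI hdeg); split=> // [q|].
  apply: inj_surj_bij; first exact: cell_of_inj.
  exact: cell_of_surj.
exists (@binc n e); first exact: binc_incidence.
split=> [q p|q v|v|f].
- exact: boxlabel_cell_of.
- rewrite /diffC /diffP !linext_comp; apply: eq_linext => p.
  rewrite linext_fbasis; apply/esym; exact: cellmap_diffP_basis.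
- rewrite /augC /augP linext_comp; apply: eq_linext => p.
  by rewrite linext_fbasis boxlabel_cell0.
- exact: bpol_ideal_image.
Qed.
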